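(* Suppose the loop-free matroid $\mathcal M$ can be extended to a (possibly infinite) modular matroid $\mathcal N$. Then any tropical toric vector bundle class $[(\mathcal M,\Phi)]$ over $\mathbb P^1$ splits.
   Context: Matroids have finite rank $r$ (the ground set may be infinite where indicated). For a loop-free matroid $\mathcal M$, $\operatorname{Berg}(\mathcal M)\subset\mathbb R^{\mathcal M}$ is the set of $w$ such that for every circuit $C$ the minimum $\min_{i\in C}w_i$ is attained at least twice (equivalently, all sets $F^w_t=\{i:w_i\ge t\}$ are flats). For a basis $B$, the apartment $A_B$ is the set of $w\in\operatorname{Berg}(\mathcal M)$ with $w_e=\min\{w_b:b\in C_e\setminus\{e\}\}$ for all $e\notin B$, where $C_e$ is the unique circuit in $B\cup\{e\}$; projection to the $B$-coordinates identifies $A_B$ with $\mathbb R^B$. The fan of $\mathbb P^1$ is the fan in $\mathbb R$ (lattice $\mathbb Z$) with cones $\mathbb R_{\ge0}$, $\mathbb R_{\le0}$, $\{0\}$. A tropical toric vector bundle $(\mathcal M,\Phi)$ over $\mathbb P^1$ is a map $\Phi:\mathbb R\to\operatorname{Berg}(\mathcal M)$ with $\Phi(\mathbb Z)\subset\mathbb Z^{\mathcal M}$ such that each of $\mathbb R_{\ge0},\mathbb R_{\le0}$ is mapped into some apartment $A_B$, linearly in the coordinates $\mathbb R^B$. A matroid extension $\phi:\mathcal M_1\to\mathcal M_2$ is an injection of ground sets of matroids of equal rank such that the matroid induced by $\mathcal M_2$ on $\phi(\mathcal M_1)$ is $\mathcal M_1$. It induces $\phi_*:\operatorname{Berg}(\mathcal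 M_1)\to\operatorname{Berg}(\mathcal M_2)$, $(\phi_*w)_e=\sup\{t:e\in\operatorname{span}\phi(F^w_t)\}$ (span = matroid closure). The class $[(\mathcal M,\Phi)]$ is the equivalence class under the equivalence relation generated by $(\mathcal M_1,\Phi_1)\sim(\mathcal M_2,\phi_*\circ\Phi_1)$ for extensions $\phi$. A pair $(\mathcal M,\Phi)$ is split if the image of $\Phi$ lies in a single apartment of $\operatorname{Berg}(\mathcal M)$; a class splits if it contains a split pair. A matroid is modular if $\operatorname{rank}(F_1)+\operatorname{rank}(F_2)=\operatorname{rank}(\operatorname{span}(F_1\cup F_2))+\operatorname{rank}(F_1\cap F_2)$ for all flats $F_1,F_2$. *)

(* Defs.v *)
From Stdlib Require Import Relation_Operators.
From HB Require Import structures.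
From mathcomp Require Import all_boot all_order all_algebra finmap.
From mathcomp Require Import boolp classical_sets cardinality reals.

Set Implicit Arguments.
Unset Strict Implicit.
Unset Printing Implicit Defensive.

Import Order.TTheory GRing.Theory Num.Theory.

Local Open Scope fset_scope.
Local Open Scope classical_set_scope.
Local Open Scope ring_scope.

(* Matroids of finite rank on a possibly infinite ground set. Finite rank     *)
(* makes every independent set, basis and circuit finite.                     *)
Record matroid (E : choiceType) := Matroid {
  indep : {fset E} -> Prop ;
  indep0 : indep fset0 ;
  indep_sub : forall I J : {fset E}, (I `<=` J)%fset -> indep J -> indep I ;
  indep_aug : forall I J : {fset E}, indep I -> indep J ->
    (#|` I| < #|` J|)%N ->
    exists2 x, x \in (J `\` I)%fset & indep (x |` I)%fset ;
  finite_rank : exists r : nat, forall I, indep I -> (#|` I| <= r)%N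
}.

Section Matroid.
Variables (E : choiceType) (M : matroid E).

Definition loop_free : Prop := forall e, indep M [fset e]%fset.

Definition basis (B : {fset E}) : Prop :=
  indep M B /\ forall I, indep M I -> (B `<=` I)%fset -> I = B.

Definition circuit (C : {fset E}) : Prop :=
  ~ indep M C /\ forall D, (D `<` C)%fset -> indep M D.

Definition indep_size (A : set E) : pred nat := fun n =>
  `[< exists I, [/\ indep M I, [set` I] `<=` A & #|` I| = n] >].

Lemma indep_size_ex (A : set E) : exists n, indep_size A n.
Proof.
exists 0%N; apply/asboolP; exists fset0; split; first exact: indep0.
- by move=> x /=; rewrite inE.
- exact: cardfs0.
Qed.

Lemma indep_size_ub (A : set E) (n : nat) :
  indep_size A n -> (n <= projT1 (cid (finite_rank M)))%N.
Proof. by move=> /asboolP[I [MI _ <-]]; exact: (projT2 (cid (finite_rank M))). Qed.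

Definition mrank (A : set E) : nat :=
  ex_maxn (indep_size_ex A) (@indep_size_ub A).

Definition mspan (A : set E) : set E := [set e | mrank (e |` A) = mrank A].

Definition flat (F : set E) : Prop := mspan F = F.

Definition modular : Prop := forall F1 F2, flat F1 -> flat F2 ->
  (mrank F1 + mrank F2 = mrank (mspan (F1 `|` F2)) + mrank (F1 `&` F2))%N.

End Matroid.

Definition extension (E1 E2 : choiceType) (M1 : matroid E1) (M2 : matroid E2)
    (phi : E1 -> E2) : Prop :=
  [/\ injective phi, mrank M1 [set: E1] = mrank M2 [set: E2] &
      forall I : {fset E1}, indep M1 I <-> indep M2 (phi @` I)%fset].

Section Bergman.
Variables (R : realType) (E : choiceType) (M : matroid E).

Definition is_min (A : set R) (m : R) : Prop := A m /\ lbound A m.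

Definition berg : set (E -> R) := [set w | forall C, circuit M C ->
  exists i j, [/\ i \in C, j \in C, i != j, w i = w j &
                  is_min (w @` [set` C]) (w i)]].

(* C below is unique: it is the fundamental circuit of e with respect to B.   *)
Definition apartment (B : {fset E}) : set (E -> R) := [set w | berg w /\
  forall e, e \notin B -> forall C, circuit M C -> (C `<=` e |` B)%fset ->
    is_min (w @` [set` (C `\ e)%fset]) (w e)].

Definition maps_linearly (Phi : R -> E -> R) (sigma : set R) : Prop :=
  exists B, [/\ basis M B,
    forall x, sigma x -> apartment B (Phi x) &
    exists c : E -> R, forall x b, sigma x -> b \in B -> Phi x b = c b * x].

Definition is_tropical_bundle (Phi : R -> E -> R) : Prop :=
  [/\ forall x, berg (Phi x),
      forall (n : int) e, Phi n%:~R e \is a Num.int,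
      maps_linearly Phi [set x | 0 <= x] &
      maps_linearly Phi [set x | x <= 0]].

End Bergman.

Definition superlevel (R : realType) (E : choiceType) (w : E -> R) (t : R) :
  set E := [set i | t <= w i].

(* The supremum is a maximum when w is in berg M1 and M2 is loop-free, so the *)
(* default value of sup on unbounded or empty sets is irrelevant.             *)
Definition pushforward (R : realType) (E1 E2 : choiceType) (M2 : matroid E2)
    (phi : E1 -> E2) (w : E1 -> R) : E2 -> R :=
  fun e => sup [set t | mspan M2 (phi @` superlevel w t) e].

(* With fin = true the matroids carrying bundles, and hence all members of a  *)
(* class, have finite ground sets; with fin = false the ground sets are       *)
(* arbitrary.                                                                 *)
Record tropical_bundle (R : realType) (fin : bool) := TropicalBundle {
  tb_ground : choiceType ;
  tb_matroid : matroid tb_ground ;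
  tb_map : R -> tb_ground -> R ;
  tb_finite : fin -> finite_set [set: tb_ground] ;
  tb_loop_free : loop_free tb_matroid ;
  tb_bundle : is_tropical_bundle tb_matroid tb_map
}.

Arguments tb_map {R fin} _ _ _.

Section BundleClass.
Variables (R : realType) (fin : bool).
Implicit Types p q : tropical_bundle R fin.

Definition tb_extends p q : Prop :=
  exists2 phi : tb_ground p -> tb_ground q,
    extension (tb_matroid p) (tb_matroid q) phi &
    tb_map q = (fun x => pushforward (tb_matroid q) phi (tb_map p x)).

(* A plain predicate: tropical_bundle lives in too large a universe for set.  *)
Definition tb_class p : tropical_bundle R fin -> Prop :=
  clos_refl_sym_trans (tropical_bundle R fin) tb_extends p.

Definition is_split p : Prop := exists2 B,
  basis (tb_matroid p) B &
  forall x, apartment (tb_matroid p) B (tb_map p x).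

Definition class_splits (K : tropical_bundle R fin -> Prop) : Prop :=
  exists2 q, K q & is_split q.

End BundleClass.

(* Main.v *)
Require Import Defs.
From mathcomp Require Import all_boot all_order all_algebra finmap.
From mathcomp Require Import boolp classical_sets cardinality reals.
From Stdlib Require Import Relation_Operators.

(** Over each of the two rays a bundle is homogeneous, because an apartment is
    a copy of a vector space in which the remaining coordinates are minima of
    the basis coordinates.  So the whole bundle is determined by the two points
    [Phi 1] and [Phi (-1)], each of which is a chain of flats of [M] (its
    superlevel sets) decorated with real thresholds.

    A point of the Bergman fan lies in the apartment of a basis [B] as soon as
    each of its superlevel flats is spanned by the elements of [B] that it
    contains ([apartment_of_adapted]).  Splitting therefore amounts to finding
    one basis that is adapted to two chains of flats at once.  Such a basis
    need not exist in [M], but it exists in the modular extension [N]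
    ([common_adapted_basis]): this is the matroid form of the fact that two
    flags of subspaces have a common adapted basis.  For flags [F] and [G] one
    chooses, for every [i] and [j], a relative basis of [F i+1 & G j+1] over the
    span of [F i & G j+1] and [F i+1 & G j].  By modularity the rank of that
    span is an alternating sum of ranks of intersections, so the number of
    chosen elements telescopes to the rank of [N]; being also spanning, the
    chosen elements form a basis.

    Finally [N] is cut down to the image of [M] together with the basis found
    ([adapted_extension]), so that a finite ground set stays finite and loops
    of [N] disappear.  Pushing forward along this extension replaces each
    superlevel set by the span of its image and commutes with nonnegative
    scaling ([pushforward_spec], [pushforward_scale]), so the pushed-forward
    bundle maps into the single apartment of the adapted basis. *)

Set Implicit Arguments.
Unset Strict Implicit.

Import Order.TTheory GRing.Theory Num.Theory.
Local Open Scope classical_set_scope.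

(** * Rank and span *)

Section MatroidTheory.
Variables (E : choiceType) (M : matroid E).
Implicit Types (A B F G : set E) (I J K C D : {fset E}) (e : E).

Lemma mrank_basis A :
  exists I, [/\ indep M I, [set` I] `<=` A & #|` I| = mrank M A].
Proof. by rewrite /mrank; case: ex_maxnP => n /asboolP. Qed.

Lemma card_le_mrank I A : indep M I -> [set` I] `<=` A -> (#|` I| <= mrank M A)%N.
Proof.
move=> MI IA; rewrite /mrank; case: ex_maxnP => n _; apply.
by apply/asboolP; exists I.
Qed.

Lemma mrankS A B : A `<=` B -> (mrank M A <= mrank M B)%N.
Proof.
have [I [MI IA <-]] := mrank_basis A.
by move=> AB; apply: card_le_mrank => //; exact: subset_trans AB.
Qed.

Lemma mrank_fset_le I : (mrank M [set` I] <= #|` I|)%N.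
Proof.
have [J [_ JI <-]] := mrank_basis [set` I].
by apply: fsubset_leq_card; apply/fsubsetP => x /JI.
Qed.

(** Iterated augmentation; unlike the axiom, it also records that the new
    elements all come from [J]. *)
Lemma indep_extend I J : indep M I -> indep M J -> (#|` I| <= #|` J|)%N ->
  exists K, [/\ indep M K, (I `<=` K)%fset, (K `<=` I `|` J)%fset
              & #|` K| = #|` J|].
Proof.
move: {2}(#|` J| - #|` I|)%N (erefl (#|` J| - #|` I|)%N) => n.
elim: n I => [|n IHn] I dIJ MI MJ leIJ.
  exists I; split => //; first exact: fsubsetUl.
  by apply/eqP; rewrite eqn_leq leIJ -subn_eq0 dIJ.
have ltIJ : (#|` I| < #|` J|)%N by rewrite -subn_gt0 dIJ.
have [x /[!inE]/andP[xI xJ] MxI] := indep_aug MI MJ ltIJ.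
have cxI : #|` (x |` I)%fset| = #|` I|.+1 by rewrite cardfsU1 xI.
have [||K [MK IK KJ cK]] := IHn (x |` I)%fset _ MxI MJ.
- by rewrite cxI subnS dIJ.
- by rewrite cxI.
exists K; split => //; first by apply: fsubset_trans IK; exact: fsubsetU1.
apply: fsubset_trans KJ _; apply/fsubsetP => y.
by rewrite !inE => /orP[/orP[/eqP ->|->]|->]; rewrite ?xJ ?orbT.
Qed.

(** Reduces the closure, defined by ranks, to independence over one chosen basis
    [I] of [A]; the facts on spans below rest on it. *)
Lemma mem_mspan A I e : indep M I -> [set` I] `<=` A -> #|` I| = mrank M A ->
  mspan M A e <-> (e \in I \/ ~ indep M (e |` I)%fset).
Proof.
move=> MI IA cI; split=> [spe|].
  have [eI|eI] := boolP (e \in I); [by left|right=> MeI].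
  have : (#|` (e |` I)%fset| <= mrank M (e |` A))%N.
    apply: card_le_mrank => // x /=; rewrite !inE => /orP[/eqP ->|xI]; first by left.
    by right; exact: IA.
  by rewrite (spe : mrank M (e |` A) = _) cardfsU1 eI -cI ltnn.
move=> He; rewrite /mspan /=; apply/eqP; rewrite eqn_leq.
apply/andP; split; last by apply: mrankS => x; right.
have [J [MJ JA <-]] := mrank_basis (e |` A).
rewrite leqNgt -cI; apply/negP => ltIJ.
have [x /[!inE]/andP[xI xJ] MxI] := indep_aug MI MJ ltIJ.
case: (JA x xJ) => [xe|xA].
  by move: xI MxI; rewrite (xe : x = e) => eI MeI; case: He => // /(negP eI).
have : (#|` (x |` I)%fset| <= mrank M A)%N.
  by apply: card_le_mrank => // y /=; rewrite !inE => /orP[/eqP ->|/IA].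
by rewrite cardfsU1 xI -cI ltnn.
Qed.

Lemma sub_mspan A : A `<=` mspan M A.
Proof.
by move=> e Ae; rewrite /mspan /= setUidr // => x /= ->.
Qed.

Lemma mrank_span A : mrank M (mspan M A) = mrank M A.
Proof.
apply/eqP; rewrite eqn_leq (mrankS (@sub_mspan A)) andbT.
have [I [MI IA cI]] := mrank_basis A.
have [J [MJ JA <-]] := mrank_basis (mspan M A).
rewrite leqNgt -cI; apply/negP => ltIJ.
have [x /[!inE]/andP[xI xJ] MxI] := indep_aug MI MJ ltIJ.
by have [/(negP xI)|] := (mem_mspan x MI IA cI).1 (JA x xJ).
Qed.

Lemma mspanS A B : A `<=` B -> mspan M A `<=` mspan M B.
Proof.
move=> AB e.
have [I [MI IA cI]] := mrank_basis A.
have [J [MJ JB cJ]] := mrank_basis B.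
have leIJ : (#|` I| <= #|` J|)%N by rewrite cI cJ; exact: mrankS.
have [K [MK IK KIJ cK]] := indep_extend MI MJ leIJ.
have KB : [set` K] `<=` B.
  by move=> x /= /(fsubsetP KIJ); rewrite inE => /orP[/IA/AB|/JB].
move=> /(mem_mspan e MI IA cI) He.
apply/(mem_mspan e MK KB); first by rewrite cK.
case: He => [eI|nMeI]; first by left; exact: (fsubsetP IK).
by right => MeK; apply/nMeI/(indep_sub _ MeK); exact: fsetUS.
Qed.

Lemma mspan_id A : mspan M (mspan M A) = mspan M A.
Proof.
apply/seteqP; split; last exact: sub_mspan.
have [I [MI IA cI]] := mrank_basis A.
have IsA : [set` I] `<=` mspan M A by apply: subset_trans (@sub_mspan A).
move=> e; rewrite (mem_mspan e MI IsA) ?mrank_span //.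
by rewrite (mem_mspan e MI IA).
Qed.

Lemma mspan_sub A B : A `<=` mspan M B -> mspan M A `<=` mspan M B.
Proof. by move=> /mspanS; rewrite mspan_id. Qed.

Lemma flat_span A : flat M (mspan M A).
Proof. exact: mspan_id. Qed.

Lemma flatI F G : flat M F -> flat M G -> flat M (F `&` G).
Proof.
move=> fF fG; apply/seteqP; split; last exact: sub_mspan.
move=> e se; split.
  by rewrite -fF; apply: mspanS se => x [].
by rewrite -fG; apply: mspanS se => x [].
Qed.

Lemma mspan_full I A : indep M I -> [set` I] `<=` A -> (mrank M A <= #|` I|)%N ->
  A `<=` mspan M [set` I].
Proof.
move=> MI IA leA e Ae.
have cI : #|` I| = mrank M A by apply/eqP; rewrite eqn_leq leA card_le_mrank.
have cI' : #|` I| = mrank M [set` I].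
  by apply/eqP; rewrite eqn_leq card_le_mrank //= mrank_fset_le.
apply/(mem_mspan e MI _ cI') => //.
exact/(mem_mspan e MI IA cI)/sub_mspan.
Qed.

Lemma flat_eq F G : flat M F -> F `<=` G -> (mrank M G <= mrank M F)%N -> F = G.
Proof.
move=> fF FG leGF; apply/seteqP; split => //.
have [I [MI IF cI]] := mrank_basis F.
apply: (@subset_trans _ (mspan M [set` I])).
  by apply: mspan_full; rewrite ?cI //; exact: subset_trans FG.
by rewrite -[X in _ `<=` X]fF; exact: mspanS.
Qed.

(** A basis of the contraction of [B] by [A], obtained by extending a basis of
    [A] to one of [B] and discarding the part in [A]. *)
Lemma relative_basis A B : A `<=` B -> exists I, [/\ [set` I] `<=` B,
  (#|` I| + mrank M A = mrank M B)%N & B `<=` mspan M (A `|` [set` I])].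
Proof.
move=> AB.
have [I [MI IA cI]] := mrank_basis A.
have [J [MJ JB cJ]] := mrank_basis B.
have leIJ : (#|` I| <= #|` J|)%N by rewrite cI cJ; exact: mrankS.
have [K [MK IK KIJ cK]] := indep_extend MI MJ leIJ.
have KB : [set` K] `<=` B.
  by move=> x /= /(fsubsetP KIJ); rewrite inE => /orP[/IA/AB|/JB].
exists (K `\` I)%fset; split.
- by move=> x /=; rewrite inE => /andP[_ /KB].
- have := cardfsID I K.
  by rewrite (fsetIidPr IK) cI cK cJ addnC.
- apply: (subset_trans (mspan_full MK KB _)); first by rewrite cK cJ.
  apply: mspanS => x /= xK; have [xI|xI] := boolP (x \in I).
    by left; exact: IA.
  by right; rewrite /= inE xI.
Qed.

(** Independence comes for free from the count: a basis of the span inside [I]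
    already has at least as many elements as [I]. *)
Lemma basis_of_spanning I : setT `<=` mspan M [set` I] ->
  (#|` I| <= mrank M setT)%N -> basis M I.
Proof.
move=> spI leI.
have [J [MJ JI cJ]] := mrank_basis [set` I].
have cIT : (mrank M setT <= mrank M [set` I])%N.
  by rewrite -(mrank_span [set` I]); exact: mrankS.
have sJI : (J `<=` I)%fset by apply/fsubsetP.
have EJ : J = I.
  by apply/eqP; rewrite eqEfcard sJI cJ (leq_trans leI).
rewrite -EJ in spI leI *; split => // K MK JK; apply/eqP.
rewrite eq_sym eqEfcard JK cJ; apply: leq_trans cIT.
exact: card_le_mrank.
Qed.

Lemma basis_spanning I : basis M I -> setT `<=` mspan M [set` I].
Proof.
move=> [MI maxI]; apply: mspan_full => //.
have [J [MJ _ <-]] := mrank_basis setT.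
rewrite leqNgt; apply/negP => ltIJ.
have [x /[!inE]/andP[xI _] MxI] := indep_aug MI MJ ltIJ.
have := maxI _ MxI (fsubsetU1 _ _) => /fsetP/(_ x).
by rewrite !inE eqxx (negPf xI).
Qed.

Lemma loop_free_span0 : loop_free M -> mspan M set0 = set0.
Proof.
move=> lf; apply/seteqP; split=> // e.
have c0 : #|` (fset0 : {fset E})| = mrank M set0.
  apply/eqP; rewrite cardfs0 eq_sym -leqn0.
  have [I [_ I0 <-]] := mrank_basis set0.
  by rewrite leqn0 cardfs_eq0; apply/eqP/fsetP => x; rewrite inE; apply/negP => /I0.
have s0 : [set` (fset0 : {fset E})] `<=` set0 by move=> x /=; rewrite inE.
move=> /(mem_mspan e (indep0 M) s0 c0) [/[!inE]//|].
by rewrite fsetU0 => /(_ (lf e)).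
Qed.

Lemma circuit_ex D : ~ indep M D -> exists2 C, circuit M C & (C `<=` D)%fset.
Proof.
elim/finSet_rect: D => D IH nMD.
have [minD|] := pselect (forall C, (C `<` D)%fset -> indep M C).
  by exists D.
move=> /existsNP[C] /not_implyP[CD nMC].
have [C' circ C'C] := IH C CD nMC.
by exists C' => //; exact: fsubset_trans (fproper_sub CD).
Qed.

Lemma circuit_span C e : circuit M C -> e \in C -> mspan M [set` (C `\ e)%fset] e.
Proof.
move=> [nMC minC] eC.
have MC : indep M (C `\ e)%fset by apply: minC; exact: fproperD1.
apply/(mem_mspan e MC) => //; last by right; rewrite fsetD1K.
by apply/eqP; rewrite eqn_leq card_le_mrank //= mrank_fset_le.
Qed.

(** If some [b] of [C] were missing from [J], then [C] without [b] could be
    completed, inside [e |` I], to an independent set of size [#|` I|].  That set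
    avoids [b], as it cannot contain [C], so it is [e |` I] without [b], which
    contains the dependent set [e |` J]. *)
Lemma fundamental_circuit_sub I J C e :
  indep M I -> e \notin I -> (J `<=` I)%fset -> mspan M [set` J] e ->
  circuit M C -> (C `<=` e |` I)%fset -> (C `<=` e |` J)%fset.
Proof.
move=> MI eI JI spe [nMC minC] CI.
apply/fsubsetP => b bC; rewrite !inE; apply/norP => -[be bJ].
have bI : b \in I by have := fsubsetP CI b bC; rewrite !inE (negPf be).
have MCb : indep M (C `\ b)%fset by apply: minC; exact: fproperD1.
have leC : (#|` (C `\ b)%fset| <= #|` I|)%N.
  have := fsubset_leq_card CI.
  by rewrite cardfsU1 eI (cardfsD1 b C) bC.
have [K [MK CK KI cK]] := indep_extend MCb MI leC.
have bK : b \notin K.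
  apply/negP => bK; apply/nMC/(indep_sub _ MK)/fsubsetP => x xC.
  by have [->//|xb] := eqVneq x b; apply: (fsubsetP CK); rewrite !inE xb.
have KE : K = ((e |` I) `\ b)%fset.
  apply/eqP; rewrite eqEfcard; apply/andP; split.
    rewrite fsubsetD1 bK andbT; apply: fsubset_trans KI _; apply/fsubsetP => x.
    rewrite !inE => /orP[/andP[_ xC]|->]; last by rewrite orbT.
    by have := fsubsetP CI x xC; rewrite !inE.
  rewrite cK; have := cardfsD1 b (e |` I)%fset.
  by rewrite cardfsU1 eI !inE bI orbT !add1n => -[->].
have MeJ : indep M (e |` J)%fset.
  apply: indep_sub MK; rewrite KE; apply/fsubsetP => x.
  rewrite !inE => /orP[/eqP ->|xJ]; first by rewrite eqxx eq_sym be.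
  by rewrite (fsubsetP JI x xJ) orbT andbT; apply: contraNneq bJ => <-.
have MJ := indep_sub JI MI.
have eJ : e \notin J by apply: contra eI; exact: (fsubsetP JI).
have [||/(negP eJ)//|//] := (mem_mspan e MJ _ _).1 spe => //.
by apply/eqP; rewrite eqn_leq card_le_mrank //= mrank_fset_le.
Qed.

End MatroidTheory.

(** * A basis adapted to two chains of flats of a modular matroid *)

Definition set_chain (T : Type) (S : set (set T)) : Prop :=
  forall A B, S A -> S B -> A `<=` B \/ B `<=` A.

Section Modular.
Variables (E : choiceType) (N : matroid E).
Hypothesis modN : modular N.
Implicit Types (A C : set E) (I J : {fset E}) (S T : set (set E)).

(** One step of the first flag against the whole second flag: the elements that
    must be added to [A & G j] in order to span [C & G j], simultaneously for
    all [j].  They are collected by induction along [G]; modularity applied to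
    [A & G m+1] and [C & G m], whose intersection is [A & G m], bounds their
    number by the rank of [C & G m] minus that of [A & G m]. *)
Lemma adapted_row A C (G : nat -> set E) :
    flat N A -> flat N C -> A `<=` C -> G 0%N = mspan N set0 ->
    (forall j, flat N (G j)) -> (forall j, G j `<=` G j.+1) ->
  forall m, exists I, [/\ [set` I] `<=` C `&` G m,
    (#|` I| + mrank N (A `&` G m) <= mrank N (C `&` G m))%N
    & forall j, (j <= m)%N ->
        C `&` G j `<=` mspan N ((A `&` G j) `|` ([set` I] `&` G j))].
Proof.
move=> fA fC AC G0 fG Gmono; elim=> [|m [I [ICG cI spI]]].
  exists fset0; split; first by move=> x /=; rewrite inE.
    rewrite cardfs0 add0n; apply: mrankS => x [Ax Gx]; split=> //; exact: AC.
  move=> j; rewrite leqn0 => /eqP -> x [_]; rewrite G0 => Gx.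
  exact: mspanS Gx.
pose F1 := A `&` G m.+1; pose F2 := C `&` G m.
have sF : F1 `|` F2 `<=` C `&` G m.+1.
  by move=> x [[/AC Cx Gx]|[Cx /Gmono Gx]].
have [J [JC cJ spJ]] := relative_basis N sF.
have FI : F1 `&` F2 = A `&` G m.
  apply/seteqP; split=> [x [[Ax _] [_ Gx]]//|x [Ax Gx]].
  by split; split=> //; [exact: Gmono|exact: AC].
have := modN (flatI fA (fG m.+1)) (flatI fC (fG m)).
rewrite -/F1 -/F2 FI mrank_span => modF.
(* [I] handles the span of [C & G m]; [J] fills the gap between
   [F1 | F2] and [C & G m+1]. *)
exists (I `|` J)%fset; split.
- move=> x /=; rewrite inE => /orP[/ICG[Cx /Gmono Gx]//|]; exact: JC.
- rewrite -/F1 -cJ cardfsU.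
  rewrite -/F2 in cI.
  move: cI modF; set a := #|` I|; set b := #|` J|; set r1 := mrank N F1.
  set r2 := mrank N F2; set r3 := mrank N (_ `|` _); set r4 := mrank N _.
  move=> cI modF; apply: (@leq_trans (a + b + r1)).
    by rewrite leq_add2r leq_subr.
  rewrite (addnC a) -addnA leq_add2l -(leq_add2r r4) -modF addnAC [leqRHS]addnC.
  by rewrite leq_add2r.
- move=> j; rewrite leq_eqVlt => /orP[/eqP ->|]; last first.
    rewrite ltnS => /spI; move/subset_trans; apply; apply: mspanS => x [|[xI Gx]].
      by left.
    by right; split=> //=; rewrite inE (xI : x \in I).
  apply: (subset_trans spJ); apply: mspan_sub => x [[AGx|]|xJ].
  + by apply: sub_mspan; left.
  + move=> /(spI m (leqnn _)); apply: mspanS => y [[Ay /Gmono Gy]|[yI /Gmono Gy]].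
      by left.
    by right; split=> //=; rewrite inE (yI : y \in I).
  + apply: sub_mspan; right; split; last by case: (JC x xJ).
    by rewrite /= inE (xJ : x \in J) orbT.
Qed.

(** The rows are stacked along [F].  Only an upper bound on the size of [I] is
    carried along, since a spanning set of at most the full rank is a basis. *)
Lemma adapted_grid (F G : nat -> set E) m :
    F 0%N = mspan N set0 -> G 0%N = mspan N set0 ->
    (forall i, flat N (F i)) -> (forall j, flat N (G j)) ->
    (forall i, F i `<=` F i.+1) -> (forall j, G j `<=` G j.+1) ->
  forall k, exists I, (#|` I| <= mrank N (F k `&` G m))%N /\
    forall i j, (i <= k)%N -> (j <= m)%N ->
      F i `&` G j `<=` mspan N ([set` I] `&` (F i `&` G j)).
Proof.
move=> F0 G0 fF fG Fmono Gmono; elim=> [|k [I [cI spI]]].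
  exists fset0; split; first by rewrite cardfs0.
  move=> i j; rewrite leqn0 => /eqP -> _ x [+ _]; rewrite F0 => Fx.
  exact: mspanS Fx.
have [J [JF cJ spJ]] :=
  adapted_row (fF k) (fF k.+1) (Fmono k) G0 fG Gmono m.
exists (I `|` J)%fset; split.
  rewrite cardfsU; apply: leq_trans (leq_subr _ _) _; rewrite addnC.
  by apply: leq_trans cJ; rewrite leq_add2l.
move=> i j; rewrite leq_eqVlt => /orP[/eqP ->|]; last first.
  rewrite ltnS => lei lej; apply: (subset_trans (spI i j lei lej)).
  by apply: mspanS => x [xI Fx]; split=> //=; rewrite inE (xI : x \in I).
move=> lej; apply: (subset_trans (spJ j lej)); apply: mspan_sub => x [|[xJ Gx]].
  move=> /(spI k j (leqnn _) lej); apply: mspanS => y [yI [Fy Gy]].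
  by split; [rewrite /= inE (yI : y \in I)|split=> //; exact: Fmono].
apply: sub_mspan; split; first by rewrite /= inE (xJ : x \in J) orbT.
by split=> //; case: (JF x xJ).
Qed.

Definition flat_chain (S : set (set E)) : Prop :=
  (forall A, S A -> flat N A) /\ set_chain S.

(** Indexing a chain by rank turns it into a sequence, on which one can do
    induction.  The strict bound in [U] makes [F 0] the span of the empty set,
    which puts a member of rank [r] at index [r + 1]; the full set is
    added so that the flag ends there. *)
Lemma chain_flag (S : set (set E)) : flat_chain S ->
  exists F : nat -> set E, [/\ F 0%N = mspan N set0, forall i, flat N (F i),
    forall i, F i `<=` F i.+1, F (mrank N setT).+1 = setT &
    forall A, S A -> exists2 i, (i <= (mrank N setT).+1)%N & F i = A].
Proof.
move=> [flatS totS].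
pose S' A := S A \/ A = setT.
have flatS' A : S' A -> flat N A.
  by move=> [/flatS//| ->]; apply/seteqP; split=> //; exact: sub_mspan.
have totS' A B : S' A -> S' B -> A `<=` B \/ B `<=` A.
  move=> [SA|->]; last by right.
  by move=> [SB|->]; [exact: totS|left].
pose U i := [set e | exists A, [/\ S' A, (mrank N A < i)%N & A e]].
pose F i := mspan N (U i).
have FE A : S' A -> F (mrank N A).+1 = A.
  move=> SA; rewrite /F; have -> : U (mrank N A).+1 = A; last exact: flatS'.
  apply/seteqP; split=> [e [B [SB]]|e Ae]; last by exists A.
  rewrite ltnS => leBA Be; have [AB|BA] := totS' _ _ SA SB; last exact: BA.
  by rewrite (flat_eq (flatS' _ SA) AB leBA).
exists F; split.
- by congr mspan; apply/seteqP; split=> // e [A []].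
- by move=> i; exact: flat_span.
- move=> i; apply: mspanS => e [A [SA ltAi Ae]]; exists A; split=> //.
  exact: ltnW.
- by apply: FE; right.
- move=> A SA; exists (mrank N A).+1; last by apply: FE; left.
  by rewrite ltnS; exact: mrankS.
Qed.

(** A spanning family for all the intersections [F i & G j] spans in particular
    each [F i] and each [G j], because both flags end with the full set. *)
Lemma common_adapted_basis (S T : set (set E)) :
  flat_chain S -> flat_chain T -> exists2 B, basis N B &
    forall A, S A \/ T A -> A `<=` mspan N ([set` B] `&` A).
Proof.
move=> /chain_flag[F [F0 fF Fmono FT FS]] /chain_flag[G [G0 fG Gmono GT GS]].
have [B [cB spB]] :=
  adapted_grid (mrank N setT).+1 F0 G0 fF fG Fmono Gmono (mrank N setT).+1.
exists B.
  apply: basis_of_spanning; last by apply: leq_trans cB _; exact: mrankS.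
  have := spB _ _ (leqnn _) (leqnn _).
  by rewrite FT GT !setIT.
move=> A [/FS[i lei <-]|/GS[j lej <-]].
  by have := spB _ _ lei (leqnn _); rewrite GT !setIT.
by have := spB _ _ (leqnn _) lej; rewrite FT !setTI.
Qed.

End Modular.

(** * Restricting a matroid along an injection *)

Lemma fset_preimage (D E : choiceType) (j : D -> E) (A : set D) (J : {fset E}) :
  [set` J] `<=` j @` A -> exists2 I : {fset D}, [set` I] `<=` A & J = (j @` I)%fset.
Proof.
elim/finSet_rect: J => J IH JA.
have [->|[x xJ]] := fset_0Vmem J.
  by exists fset0; [move=> x /=; rewrite inE|rewrite imfset0].
have [a Aa ax] := JA x xJ.
have [|y yJ|I IA EI] := IH (J `\ x)%fset; first exact: fproperD1.
  by apply: JA; move: yJ; rewrite /= !inE => /andP[].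
exists (a |` I)%fset; last by rewrite imfsetU1 -EI ax fsetD1K.
by move=> y /=; rewrite !inE => /orP[/eqP ->|/IA].
Qed.

Section Restriction.
Variables (D E : choiceType) (j : D -> E).
Hypothesis inj_j : injective j.

Lemma card_inj_imfset (I : {fset D}) : #|` (j @` I)%fset| = #|` I|.
Proof. by rewrite card_imfset. Qed.

Lemma restriction_sub (M : matroid E) (I J : {fset D}) :
  (I `<=` J)%fset -> indep M (j @` J)%fset -> indep M (j @` I)%fset.
Proof.
move=> /fsubsetP IJ; apply: indep_sub; apply/fsubsetP => y /imfsetP[x xI ->].
by apply: in_imfset; exact: IJ.
Qed.

Lemma restriction_aug (M : matroid E) (I J : {fset D}) :
    indep M (j @` I)%fset -> indep M (j @` J)%fset -> (#|` I| < #|` J|)%N ->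
  exists2 x, x \in (J `\` I)%fset & indep M (j @` (x |` I))%fset.
Proof.
move=> MI MJ; rewrite -(card_inj_imfset I) -(card_inj_imfset J) => ltIJ.
have [y /[!inE]/andP[yI /imfsetP[x xJ yx]] My] := indep_aug MI MJ ltIJ.
exists x; last by rewrite imfsetU1 -yx.
rewrite inE (xJ : x \in J) andbT; apply: contra yI => xI.
by rewrite yx; exact: in_imfset.
Qed.

Lemma restriction_rank (M : matroid E) :
  exists r : nat, forall I : {fset D}, indep M (j @` I)%fset -> (#|` I| <= r)%N.
Proof.
have [r ler] := finite_rank M.
by exists r => I /ler; rewrite card_inj_imfset.
Qed.

Definition restriction (M : matroid E) : matroid D := {|
  indep := fun I => indep M (j @` I)%fset ;
  indep0 := eq_ind_r (indep M) (indep0 M) (imfset0 j) ;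
  indep_sub := @restriction_sub M ;
  indep_aug := @restriction_aug M ;
  finite_rank := restriction_rank M |}.

Variables (M1 : matroid D) (M2 : matroid E).
Hypothesis indepE : forall I : {fset D}, indep M1 I <-> indep M2 (j @` I)%fset.

Lemma mrank_restriction (A : set D) : mrank M1 A = mrank M2 (j @` A).
Proof.
apply/eqP; rewrite eqn_leq; apply/andP; split.
  have [I [/indepE MI IA <-]] := mrank_basis M1 A.
  rewrite -card_inj_imfset; apply: card_le_mrank => // y /= /imfsetP[x xI ->].
  by exists x => //; exact: IA.
have [J [MJ /fset_preimage[I IA EJ] <-]] := mrank_basis M2 (j @` A).
rewrite EJ card_inj_imfset; apply: card_le_mrank => //.
by apply/indepE; rewrite -EJ.
Qed.

Lemma mspan_restriction (A : set D) (e : D) :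
  mspan M1 A e <-> mspan M2 (j @` A) (j e).
Proof.
rewrite /mspan /= !mrank_restriction image_setU image_set1; split => //.
Qed.

End Restriction.

Local Open Scope ring_scope.

(** * Bergman fan and apartments *)

Lemma fset_argmax (R : realType) (T : choiceType) (B : {fset T}) (P : T -> Prop)
    (f : T -> R) : (exists2 b, b \in B & P b) ->
  exists b, [/\ b \in B, P b & forall c, c \in B -> P c -> f c <= f b].
Proof.
move=> [b bB Pb]; pose p (x : B) := `[< P (val x) >].
have pb : p [` bB]%fset by apply/asboolP.
case: (arg_maxP (fun x : B => f (val x)) pb) => x /asboolP Px maxx.
exists (val x); split=> // [|c cB Pc]; first exact: valP.
by have := maxx [` cB]%fset; apply; apply/asboolP.
Qed.

Section Apartments.
Variables (R : realType) (E : choiceType) (M : matroid E).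
Implicit Types (w : E -> R) (a t : R) (B C : {fset E}).

Lemma is_min_scale w a (A : set E) (x : R) : 0 <= a ->
  is_min (w @` A) x -> is_min ((fun e => a * w e) @` A) (a * x).
Proof.
move=> a0 [[e Ae <-] minx]; split; first by exists e.
by move=> _ [i Ai <-]; apply: ler_wpM2l => //; apply: minx; exists i.
Qed.

Lemma is_min_uniq (A : set R) (x y : R) : is_min A x -> is_min A y -> x = y.
Proof.
by move=> [Ax lx] [Ay ly]; apply/eqP; rewrite eq_le lx //= ly.
Qed.

(** If the minimum on a circuit [C] were attained only at [i], the superlevel
    set at the second smallest value would contain [C] without [i] but not [i],
    although [i] lies in the span of [C] without [i]. *)
Lemma berg_of_flats w : loop_free M -> (forall t, flat M (superlevel w t)) ->
  berg M w.
Proof.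
move=> lf flatw C circC.
have [e eC] : exists e, e \in C.
  have [C0|[e eC]] := fset_0Vmem C; last by exists e.
  by case: circC; rewrite C0 => /(_ (indep0 M)).
have [i [iC _ mini]] : exists i, [/\ i \in C, True &
    forall k, k \in C -> True -> - w k <= - w i].
  by apply: fset_argmax; exists e.
(* [k] realizes the smallest value on the rest of the circuit, which is
   nonempty because [i] is not a loop. *)
have [k [kC _ mink]] : exists k, [/\ k \in (C `\ i)%fset, True &
    forall l, l \in (C `\ i)%fset -> True -> - w l <= - w k].
  apply: fset_argmax; have [C0|[k kC]] := fset_0Vmem (C `\ i)%fset; last by exists k.
  by have := circuit_span circC iC; rewrite C0 set_fset0 loop_free_span0.
move: kC; rewrite !inE => /andP[ki kC].
have leki : w k <= w i.
  have : superlevel w (w k) i.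
    rewrite -flatw; apply: mspanS (circuit_span circC iC) => l lC.
    by rewrite /superlevel /= -lerN2; exact: mink.
  by [].
have wik : w i = w k by apply/eqP; rewrite eq_le leki andbT -lerN2 mini.
exists i, k; split=> //; first by rewrite eq_sym.
split; first by exists i.
by move=> _ [l lC <-]; rewrite -lerN2 mini.
Qed.

(** Adaptedness at the level [w e] puts [e] in the span of the [b] in [B] with
    [w b >= w e], so the fundamental circuit of [e] uses only such [b].
    Conversely the minimum of [w] on the circuit is attained twice, hence also
    away from [e], so it equals [w e]. *)
Lemma apartment_of_adapted w B : indep M B -> berg M w ->
    (forall t, superlevel w t `<=` mspan M ([set` B] `&` superlevel w t)) ->
  apartment M B w.
Proof.
move=> MB bw adw; split=> // e eB C circC CB.
have eC : e \in C.
  apply/negPn/negP => eC; case: circC => nMC _; apply/nMC/(indep_sub _ MB).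
  apply/fsubsetP => x xC; have := fsubsetP CB x xC; rewrite !inE => /orP[/eqP xe|//].
  by rewrite -xe xC in eC.
pose J := [fset b in B | w e <= w b]%fset.
have JE : [set` J] = [set` B] `&` superlevel w (w e).
  by apply/seteqP; split=> x /=; rewrite !inE; [move=> /andP|move=> /andP].
have spe : mspan M [set` J] e by rewrite JE; apply: adw; exact: lexx.
have JB : (J `<=` B)%fset by apply/fsubsetP => x; rewrite !inE => /andP[].
have CJ := fundamental_circuit_sub MB eB JB spe circC CB.
have leC x : x \in (C `\ e)%fset -> w e <= w x.
  rewrite !inE => /andP[xe xC]; have := fsubsetP CJ x xC.
  by rewrite !inE (negPf xe) => /andP[].
have [i [k [iC kC ik wik [_ mini]]]] := bw C circC.
have [l lCe wil] : exists2 l, l \in (C `\ e)%fset & w l = w i.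
  have [ie|ie] := eqVneq i e.
    by exists k => //; rewrite !inE kC andbT -ie eq_sym.
  by exists i => //; rewrite !inE iC ie.
split; last by move=> _ [x xC <-]; exact: leC.
exists l => //; apply/eqP; rewrite eq_le leC // andbT wil.
by apply: mini; exists e.
Qed.

Lemma apartment_scale w B a : 0 <= a -> apartment M B w ->
  apartment M B (fun e => a * w e).
Proof.
move=> a0 [bw apw]; split=> [C circC|e eB C circC CB].
  have [i [k [iC kC ik wik mini]]] := bw C circC.
  by exists i, k; split=> //; [rewrite wik|exact: is_min_scale].
by apply: is_min_scale => //; exact: apw.
Qed.

Lemma basis_fundamental_circuit B e : basis M B -> e \notin B ->
  exists2 C, circuit M C & (C `<=` e |` B)%fset.
Proof.
move=> [MB maxB] eB; apply: circuit_ex => MeB.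
have := maxB _ MeB (fsubsetU1 _ _) => /fsetP/(_ e).
by rewrite !inE eqxx (negPf eB).
Qed.

(** Since the basis is finite, a point of an apartment takes finitely many
    values. *)
Lemma apartment_values w B e : basis M B -> apartment M B w ->
  exists2 b, b \in B & w e = w b.
Proof.
move=> bB [_ apw]; have [eB|eB] := boolP (e \in B); first by exists e.
have [C circC CB] := basis_fundamental_circuit bB eB.
have [[b /= bC <-] _] := apw e eB C circC CB.
exists b => //; move: bC; rewrite !inE => /andP[be bC].
by have := fsubsetP CB b bC; rewrite !inE (negPf be).
Qed.

Lemma apartment_ext w w' B : basis M B -> apartment M B w -> apartment M B w' ->
  (forall b, b \in B -> w b = w' b) -> w = w'.
Proof.
move=> bB [_ apw] [_ apw'] ww'; apply: funext => e.
have [eB|eB] := boolP (e \in B); first exact: ww'.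
have [C circC CB] := basis_fundamental_circuit bB eB.
apply: is_min_uniq (apw e eB C circC CB) _.
have -> : w @` [set` (C `\ e)%fset] = w' @` [set` (C `\ e)%fset].
  apply: eq_imagel => b /=; rewrite !inE => /andP[be bC]; apply: ww'.
  by have := fsubsetP CB b bC; rewrite !inE (negPf be).
exact: apw'.
Qed.

(** Linearity in the coordinates of the apartment propagates to all coordinates,
    since minima commute with nonnegative scaling. *)
Lemma ray_homogeneous (Phi : R -> E -> R) (s : set R) (x0 : R) :
    maps_linearly M Phi s -> s x0 ->
  forall a, 0 <= a -> s (a * x0) -> Phi (a * x0) = (fun e => a * Phi x0 e).
Proof.
move=> [B [bB apB [c Phic]]] sx0 a a0 sax0.
apply: (apartment_ext bB); first exact: apB.
  by apply: apartment_scale => //; exact: apB.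
by move=> b bin; rewrite !Phic // mulrCA.
Qed.

End Apartments.

(** * Pushforward along an extension *)

Section Pushforward.
Variables (R : realType) (E1 E2 : choiceType) (M1 : matroid E1) (M2 : matroid E2).
Variables (phi : E1 -> E2).
Hypotheses (lf2 : loop_free M2) (ext : extension M1 M2 phi).
Implicit Types (w : E1 -> R) (t a : R).

Lemma extension_spanning : mspan M2 (phi @` setT) = setT.
Proof.
case: ext => inj_phi rk indE; apply/seteqP; split=> // e _.
have sT : flat M2 setT by apply/seteqP; split=> //; exact: sub_mspan.
rewrite (flat_eq (@flat_span _ M2 (phi @` setT)) (@subsetT _ _)) //.
by rewrite mrank_span -(mrank_restriction inj_phi indE) rk.
Qed.

Definition finitely_valued w :=
  exists B : {fset E1}, forall e, exists2 b, b \in B & w e = w b.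

(** Because [w] has finitely many values, each superlevel set is empty or is the
    superlevel set at some value of [w].  As [e] is not a loop, the supremum is
    therefore attained, at a value of [w]; the second clause is what preserves
    integrality. *)
Lemma pushforward_spec w e : finitely_valued w ->
  (forall t, t <= pushforward M2 phi w e <-> mspan M2 (phi @` superlevel w t) e)
  /\ exists b, pushforward M2 phi w e = w b.
Proof.
move=> [B wB]; rewrite /pushforward.
set S := [set t | _].
have Smono t u : t <= u -> S u -> S t.
  move=> tu; apply: mspanS => _ [i ui <-]; exists i => //; exact: le_trans tu ui.
have Snext t : S t -> exists2 b, b \in B & t <= w b /\ S (w b).
  move=> St.
  have [c [cB tc minc]] : exists c, [/\ c \in B, t <= w c &
      forall b, b \in B -> t <= w b -> - w b <= - w c].
    apply: fset_argmax; apply: contrapT => noB; move: St; rewrite /S /=.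
    have -> : superlevel w t = set0.
      apply/seteqP; split=> // i ti; apply: noB.
      by have [b bB wib] := wB i; exists b => //; rewrite -wib.
    by rewrite image_set0 loop_free_span0.
  exists c => //; split=> //.
  apply: mspanS St => _ [i ti <-]; exists i => //.
  have [b bB wib] := wB i.
  by rewrite /superlevel /= wib -lerN2; apply: minc => //; rewrite -wib.
have [t0 St0] : exists t, S t.
  have [i _] : exists i : E1, True.
    apply: contrapT => noE.
    have : mspan M2 (phi @` setT) e by rewrite extension_spanning.
    have -> : phi @` setT = set0.
      by apply/seteqP; split=> // _ [i _ <-]; apply: noE; exists i.
    by rewrite loop_free_span0.
  have [c [cB _ minc]] : exists c, [/\ c \in B, True &
      forall b, b \in B -> True -> - w b <= - w c].
    by apply: fset_argmax; have [b bB _] := wB i; exists b.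
  exists (w c); rewrite /S /=.
  have -> : superlevel w (w c) = setT; last by rewrite extension_spanning.
  apply/seteqP; split=> // k _; have [b bB wkb] := wB k.
  by rewrite /superlevel /= wkb -lerN2 minc.
have [b0 b0B [_ Sb0]] := Snext t0 St0.
have [m [mB Sm maxm]] : exists m, [/\ m \in B, S (w m) &
    forall b, b \in B -> S (w b) -> w b <= w m].
  by apply: fset_argmax; exists b0.
have ubm : ubound S (w m).
  by move=> t /Snext[b bB [tb Sb]]; apply: le_trans tb _; exact: maxm.
have supS : sup S = w m.
  apply/eqP; rewrite eq_le; apply/andP; split.
    by apply: ge_sup => //; exists (w m).
  by apply: ub_le_sup => //; exists (w m).
rewrite supS; split; last by exists m.
by move=> t; split=> [tm|]; [exact: Smono Sm|exact: ubm].
Qed.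

Lemma superlevel_pushforward w t : finitely_valued w ->
  superlevel (pushforward M2 phi w) t = mspan M2 (phi @` superlevel w t).
Proof.
by move=> fw; apply/seteqP; split=> e; have [/(_ t) spec _] := pushforward_spec e fw;
  move=> /spec.
Qed.

Lemma pushforward_scale w a : finitely_valued w -> 0 <= a ->
  pushforward M2 phi (fun e => a * w e) = (fun e => a * pushforward M2 phi w e).
Proof.
move=> fw a0; apply: funext => e.
have faw : finitely_valued (fun e => a * w e).
  by have [B wB] := fw; exists B => i; have [b bB ->] := wB i; exists b.
have [spw _] := pushforward_spec e fw.
have [spaw [b awb]] := pushforward_spec e faw.
move: a0; rewrite le_eqVlt => /orP[/eqP a0|a0]; first by rewrite awb -a0 !mul0r.
have slE t : superlevel (fun e => a * w e) t = superlevel w (t / a).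
  by apply/seteqP; split=> i; rewrite /superlevel /= ler_pdivrMr // mulrC.
apply/eqP; rewrite eq_le; apply/andP; split.
  by rewrite mulrC -ler_pdivrMr //; apply/spw; rewrite -slE; apply/spaw.
apply/spaw; rewrite slE; apply/spw.
by rewrite mulrC mulKf ?lt0r_neq0.
Qed.

End Pushforward.

(** * The splitting extension *)

Definition adapted (E1 E2 : choiceType) (M2 : matroid E2) (phi : E1 -> E2)
    (B : {fset E2}) (A : set E1) : Prop :=
  mspan M2 (phi @` A) `<=` mspan M2 ([set` B] `&` mspan M2 (phi @` A)).

Lemma span_chain (E X : choiceType) (N : matroid X) (f : E -> X)
    (S : set (set E)) : set_chain S ->
  flat_chain N [set mspan N (f @` A) | A in S].
Proof.
move=> totS; split=> [_ [A _ <-]|_ _ [A SA <-] [B SB <-]]; first exact: flat_span.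
by have [AB|BA] := totS A B SA SB; [left|right]; apply/mspanS/image_subset.
Qed.

(** The ground set consists of the image of [M] and the adapted basis [B] of
    [N]: just enough to contain [B], so that finiteness is inherited from [M],
    and free of loops even when [N] has some. *)
Lemma adapted_extension (E X : choiceType) (M : matroid E) (N : matroid X)
    (f : E -> X) (S T : set (set E)) :
    loop_free M -> extension M N f -> modular N -> set_chain S -> set_chain T ->
  exists (Y : choiceType) (M' : matroid Y) (phi : E -> Y) (B : {fset Y}),
    [/\ finite_set [set: E] -> finite_set [set: Y], loop_free M',
        extension M M' phi, basis M' B &
        forall A, S A \/ T A -> adapted M' phi B A].
Proof.
move=> lfM [inj_f rk indE] modN chS chT.
have [B bB adB] := common_adapted_basis modN (span_chain N f chS) (span_chain N f chT).
pose P : pred X := fun x => `[< range f x \/ x \in B >].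
have Pf e : P (f e) by apply/asboolP; left; exists e.
pose Y : choiceType := {x : X | P x}.
pose j : Y -> X := val.
have inj_j : injective j by exact: val_inj.
pose M' := restriction inj_j N.
have indE' (I : {fset Y}) : indep M' I <-> indep N (j @` I)%fset by [].
pose phi e : Y := exist _ (f e) (Pf e).
have jphi A : j @` (phi @` A) = f @` A by rewrite image_comp.
have [BY _ EB] : exists2 BY : {fset Y}, [set` BY] `<=` setT & B = (j @` BY)%fset.
  apply: fset_preimage => x xB; have Px : P x by apply/asboolP; right.
  by exists (exist _ x Px).
have MBY : indep M' BY by apply/indE'; rewrite -EB; case: bB.
exists Y, M', phi, BY; split.
- move=> finE.
  have finP : finite_set [set x | P x].
    apply: (@sub_finite_set _ _ (range f `|` [set` B])).
      by move=> x /asboolP.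
    by rewrite finite_setU; split; [exact: finite_image|exact: finite_fset].
  have [K KP] := finite_fsetP.1 finP.
  have [KY _ EK] : exists2 KY : {fset Y}, [set` KY] `<=` setT & K = (j @` KY)%fset.
    apply: fset_preimage => x xK; have Px : P x by have : [set` K] x by []; rewrite -KP.
    by exists (exist _ x Px).
  apply/finite_fsetP; exists KY; apply/seteqP; split=> // y _.
  have : [set` K] (j y) by rewrite -KP; exact: valP y.
  by rewrite EK /= mem_imfset.
- move=> y; apply/indE'; rewrite imfset_fset1.
  have /asboolP[[e _ fe]|yB] := valP y.
    by rewrite /j -fe -imfset_fset1; apply/indE.
  by apply: indep_sub bB.1; rewrite fsub1set.
- split.
  + by move=> x y /(congr1 j) /inj_f.
  + have cB : mrank N setT = #|` BY|.
      apply/eqP; rewrite -(card_inj_imfset inj_j) -EB eqn_leq card_le_mrank ?andbT //.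
        apply: leq_trans (mrank_fset_le N B); rewrite -(mrank_span N [set` B]).
        exact/mrankS/basis_spanning.
      exact: bB.1.
    apply/eqP; rewrite rk eqn_leq {1}cB card_le_mrank //=.
    by rewrite (mrank_restriction inj_j indE') mrankS.
  + by move=> I; rewrite indE indE' -imfset_comp.
- split=> // I MI BI; apply/fsetP => y.
  have /fsetP/(_ (j y)) : (j @` I)%fset = B.
    apply: bB.2; first exact/indE'.
    rewrite EB; apply/fsubsetP => _ /imfsetP[x xB ->].
    by apply: in_imfset; exact: (fsubsetP BI).
  by rewrite EB !mem_imfset.
move=> A SA y /(mspan_restriction inj_j indE'); rewrite jphi => spy.
apply/(mspan_restriction inj_j indE').
have : mspan N ([set` B] `&` mspan N (f @` A)) (j y).
  by apply: adB => //; case: SA => SA; [left|right]; exists A.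
apply: mspanS => x [xB spx].
move: xB; rewrite /= EB => /imfsetP[z zB xz]; exists z => //; split=> //.
by apply/(mspan_restriction inj_j indE'); rewrite jphi -xz.
Qed.

Lemma superlevel_chain (R : realType) (E : choiceType) (w : E -> R) :
  set_chain [set superlevel w t | t in setT].
Proof.
move=> _ _ [t _ <-] [u _ <-].
by have [tu|/ltW ut] := leP t u; [right|left] => i; apply: le_trans.
Qed.

Lemma pushforward_apartment (R : realType) (E1 E2 : choiceType)
    (M1 : matroid E1) (M2 : matroid E2) (phi : E1 -> E2) (w : E1 -> R)
    (B : {fset E2}) :
    loop_free M2 -> extension M1 M2 phi -> indep M2 B -> finitely_valued w ->
    (forall t, adapted M2 phi B (superlevel w t)) ->
  apartment M2 B (pushforward M2 phi w).
Proof.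
move=> lf2 ext MB fw adB; apply: apartment_of_adapted => //.
  apply: berg_of_flats => // t.
  by rewrite (superlevel_pushforward lf2 ext) //; exact: flat_span.
by move=> t; rewrite (superlevel_pushforward lf2 ext) //; exact: adB.
Qed.

Unset Implicit Arguments.

Theorem theorem1p16 (R : realType) (fin : bool) (E : choiceType)
    (M : matroid E) (hfin : fin -> finite_set (@setT E)) (hM : loop_free M)
    (hN : exists (X : choiceType) (N : matroid X) (iota : E -> X),
        extension M N iota /\ modular N)
    (Phi : R -> E -> R) (hPhi : is_tropical_bundle M Phi) :
  class_splits (tb_class (TropicalBundle hfin hM hPhi)).
Proof.
have [X [N [f [extN modN]]]] := hN.
have [_ intPhi linp linn] := hPhi.
have Phip x : 0 <= x -> Phi x = (fun e => x * Phi 1 e).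
  move=> x0; rewrite -[in LHS](mulr1 x).
  by apply: (ray_homogeneous linp); rewrite /= ?mulr1 ?ler01.
have Phin x : x <= 0 -> Phi x = (fun e => - x * Phi (-1) e).
  move=> x0; have {1}-> : x = - x * -1 by rewrite mulrNN mulr1.
  by apply: (ray_homogeneous linn); rewrite /= ?mulrNN ?mulr1 ?oppr_ge0 ?lerN10.
have fvPhi x : finitely_valued (Phi x).
  have [x0|/ltW x0] := leP 0 x.
    have [B [bB apB _]] := linp.
    by exists B => e; apply: (apartment_values _ bB); exact: apB.
  have [B [bB apB _]] := linn.
  by exists B => e; apply: (apartment_values _ bB); exact: apB.
have [Y [M' [phi [B [finY lfY extY bB adB]]]]] := adapted_extension hM extN modN
  (@superlevel_chain _ _ (Phi 1)) (@superlevel_chain _ _ (Phi (-1))).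
pose Psi x := pushforward M' phi (Phi x).
have Psip x : 0 <= x -> Psi x = (fun e => x * Psi 1 e).
  by move=> x0; rewrite /Psi (Phip x x0) (pushforward_scale lfY extY).
have Psin x : x <= 0 -> Psi x = (fun e => - x * Psi (-1) e).
  by move=> x0; rewrite /Psi (Phin x x0) (pushforward_scale lfY extY) ?oppr_ge0.
have apPsi x : apartment M' B (Psi x).
  have [x0|/ltW x0] := leP 0 x.
    rewrite Psip //; apply: apartment_scale => //.
    apply: (pushforward_apartment lfY extY bB.1) => // t.
    by apply: adB; left; exists t.
  rewrite Psin //; apply: apartment_scale; first by rewrite oppr_ge0.
  apply: (pushforward_apartment lfY extY bB.1) => // t.
  by apply: adB; right; exists t.
have hPsi : is_tropical_bundle M' Psi.
  split.
  - by move=> x; case: (apPsi x).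
  - move=> n e; rewrite /Psi; have [_ [b ->]] := pushforward_spec lfY extY e (fvPhi n%:~R).
    exact: intPhi.
  - exists B; split=> //; exists (Psi 1) => x b x0 _.
    by rewrite Psip // mulrC.
  - exists B; split=> //; exists (fun e => - Psi (-1) e) => x b x0 _.
    by rewrite Psin // mulNr mulrC mulNr.
have hfinY : fin -> finite_set (@setT Y) by move=> /hfin.
exists (TropicalBundle hfinY lfY hPsi); last by exists B.
by apply: rst_step; exists phi.
Qed.
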